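(* Let $q\geq 2$ be a prime power. In $\mathrm{PG}(1,q^3)$ the following hold. \begin{enumerate} \item For each $x\in\{1,2,q,q+1,q+2,2q\}$ there exist two clubs that meet in exactly $x$ points. \item There exist two clubs whose intersection is exactly one $\mathbb{F}_q$-line; this occurs both for two (distinct) clubs with a common head and for two clubs with distinct heads. \end{enumerate}
   Context: Field reduction: the points of $\mathrm{PG}(1,q^3)$ are the $1$-dimensional $\mathbb{F}_{q^3}$-subspaces of $\mathbb{F}_{q^3}^2$. Viewing $\mathbb{F}_{q^3}^2$ as a $6$-dimensional $\mathbb{F}_q$-space, they become the planes of a regular (Desarguesian) $2$-spread $\mathcal{S}$ of $\mathrm{PG}(5,q)$. For a plane $\pi$ of $\mathrm{PG}(5,q)$, $B(\pi)$ denotes the set of points $X$ of $\mathrm{PG}(1,q^3)$ whose corresponding spread plane meets $\pi$. A club is a set $B(\pi)$ where $\pi$ is a plane of $\mathrm{PG}(5,q)$ not in $\mathcal{S}$ that meets a unique spread plane $\alpha$ in a line (and so meets $q^2$ further spread planes in a point); it has size $q^2+1$. The point of the club corresponding to $\alpha$ is called its head (the head is uniquely determined by the club). An $\mathbb{F}_q$-line of $\mathrm{PG}(1,q^3)$ is a subline $\mathrm{PG}(1,q)$, i.e. an image of the canonical subline $\mathrm{PG}(1,q)$ under $\mathrm{PGL}(2,q^3)$; it has $q+1$ points. *)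

(* Defs.v *)
From HB Require Import structures.
From mathcomp Require Import all_boot all_order all_algebra all_field.
From mathcomp Require Import boolp classical_sets functions cardinality.

Set Implicit Arguments.
Unset Strict Implicit.
Unset Printing Implicit Defensive.

Import GRing.Theory.
Local Open Scope ring_scope.
Local Open Scope classical_set_scope.

Section Clubs.
Variables (F : finFieldType) (L : fieldExtType F).

(* The set of pairs over L carries two vector space structures: [L2] is
   two-dimensional over L, while [redL2] is the same set over F, so that its
   dimension is [2 * \dim {:L}]. *)
Definition L2 : vectType L := (L^o * L^o)%type.
Definition redL2 : vectType F := (L * L)%type.

Definition PG1 : set {vspace L2} := [set X | \dim X = 1%N].

Definition scale_map (v : L2) : 'Hom(L, redL2) :=
  linfun (fun a : L => (a * v.1, a * v.2) : redL2).

(* Field reduction: X regarded as a subspace over F; see [memv_field_red]. *)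
Definition field_red (X : {vspace L2}) : {vspace redL2} :=
  (\sum_(v <- vbasis X) limg (scale_map v))%VS.

Definition spread : set {vspace redL2} := field_red @` PG1.

(* Projective dimension is vector space dimension minus one: planes have
   [\dim] equal to 3, lines have [\dim] equal to 2. *)
Definition plane : set {vspace redL2} := [set p | \dim p = 3%N].

Definition B (p : {vspace redL2}) : set {vspace L2} :=
  [set X | PG1 X /\ (field_red X :&: p)%VS <> 0%VS].

Definition meets_in_line (p : {vspace redL2}) (X : {vspace L2}) : Prop :=
  PG1 X /\ \dim (field_red X :&: p) = 2%N.

Definition club_plane (p : {vspace redL2}) : Prop :=
  [/\ plane p, ~ spread p & exists! X, meets_in_line p X].

Definition is_club (C : set {vspace L2}) : Prop :=
  exists2 p, club_plane p & C = B p.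

Definition is_head (C : set {vspace L2}) (H : {vspace L2}) : Prop :=
  exists p, [/\ club_plane p, C = B p & meets_in_line p H].

Definition canonical_subline : set {vspace L2} :=
  [set <[((ab.1)%:A, (ab.2)%:A) : L2]>%VS | ab in [set ab : F * F | ab <> 0]].

(* Elements of PGL(2, L) are induced by the bijective L-linear maps of [L2]. *)
Definition is_Fline (l : set {vspace L2}) : Prop :=
  exists2 g : 'End(L2),
    lker g = 0%VS & l = [set (g @: X)%VS | X in canonical_subline].

Lemma scale_mapE (v : L2) (a : L) : scale_map v a = (a * v.1, a * v.2).
Proof.
have lin_f : linear (fun a : L => (a * v.1, a * v.2) : redL2).
  by move=> k b c; congr pair; rewrite /= mulrDl -scalerAl.
pose f : {linear L -> redL2} := HB.pack (fun a : L => (a * v.1, a * v.2) : redL2)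
  (GRing.isLinear.Build _ _ _ _ _ lin_f).
exact: (lfunE f a).
Qed.

Lemma memv_field_red (X : {vspace L2}) (v : L * L) :
  ((v : redL2) \in field_red X) = ((v : L2) \in X).
Proof.
rewrite /field_red; apply/idP/idP.
  have: {subset (vbasis X : seq _) <= X} by move=> w; exact: vbasis_mem.
  elim: (vbasis X : seq _) v => [|w s IH] v sX.
    by rewrite big_nil memv0 => /eqP ->; exact: mem0v.
  rewrite big_cons => /memv_addP[_ /memv_imgP[a _ ->]] [u us ->].
  rewrite scale_mapE; apply: (@memvD _ L2).
    by apply: (@memvZ _ L2 X a w); apply: sX; exact: mem_head.
  by apply: IH us => z zs; apply: sX; rewrite inE zs orbT.
have memf (s : seq L2) (w : L2) (a : L) : w \in s ->
    (a *: w : redL2) \in (\sum_(x <- s) limg (scale_map x))%VS.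
  elim: s => // x s IH; rewrite inE big_cons => /orP[/eqP ->|/IH].
    apply: (subvP (addvSl _ _)); apply/memv_imgP; exists a; first exact: memvf.
    by rewrite scale_mapE.
  exact: (subvP (addvSr _ _)).
move=> vX; rewrite (coord_vbasis vX).
apply: (@memv_suml _ redL2) => i _; apply: memf.
by rewrite mem_nth // size_tuple.
Qed.

End Clubs.

(* Main.v *)
Require Import Defs.
From mathcomp Require Import all_boot all_order all_algebra all_field.
From mathcomp Require Import ring.
From mathcomp Require Import boolp classical_sets functions cardinality.

(** Projective points are written as elements of [option L]: [Some x] is the
point <(x, 1)> and [None] is the point <(1, 0)> at infinity.  For a two-dimensional
F-subspace [U] of [L] and an L-basis (e, f) of L^2, the F-space U e + F f is a
plane whose club consists of its head <e> and of the points <u e + f> with u in U.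
Two choices of basis are enough:
- e = (w, 0), f = (v, 1): the affine plane w U + v together with infinity, its head;
- e = (0, 1), f = (d, v): the points x with d / x in U + v, with head 0.

Let theta be a generator of [L] over [F] and let U consist of the polynomials in
theta of degree at most 1.  The first club is always U with infinity added.
A nonzero x in U lies in the second club for v = 0 exactly when d = x y for some
y in U.  When d = Q(theta) with Q of degree at most 2, this is a factorization of
the polynomial Q, as 1, theta and theta^2 are linearly independent.  Up to scalars
the number k of such x is therefore
- 0 for Q = X^2 - X - c irreducible (lemma [irreducible_quadratic]),
- 1 for Q = 1, namely 1 = 1 * 1,
- 2 for Q = X, namely X = X * 1 = 1 * X (lemma [theta_factor]).
With v = 0 both 0 and infinity are common to the two clubs, and there are
2 + k (q - 1) common points: 2, q + 1 or 2q.
With v = theta^2 only 0 is common besides the nonzero x in U with d / x in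
U + theta^2.  Each of the q + 1 - k one-dimensional F-subspaces of U with d / x
outside U contains exactly one such x (lemma [top_coef_scale]), so there are
q + 2 - k common points: q + 2 or q.

Two parallel affine planes share only infinity, which gives 1.
The case d = 1, v = 0 has F and infinity as intersection, the canonical subline,
and the heads are different.  The affine planes U and theta^-1 U also intersect
in F, which gives the canonical subline for a common head. *)

Set Implicit Arguments.
Unset Strict Implicit.
Unset Printing Implicit Defensive.

Local Open Scope classical_set_scope.

Section ClubIntersections.
Import GRing.Theory.
Local Open Scope ring_scope.
Variables (F : finFieldType) (L : fieldExtType F).
Implicit Types (X : {vspace L2 L}) (v e f : L2 L) (U : {vspace L}).

(** * The club of a plane in coordinates *)

Lemma PG1_line v : v != 0 -> PG1 <[v]>%VS.
Proof. by move=> v0; rewrite /PG1 /= dim_vline v0. Qed.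

Lemma PG1_eq X v : PG1 X -> v != 0 -> v \in X -> X = <[v]>%VS.
Proof.
rewrite /PG1 /= => dX v0 vX; apply/esym/eqP.
by rewrite eqEdim -memvE vX dX dim_vline v0.
Qed.

Definition club_space U e f : {vspace redL2 L} :=
  (scale_map e @: U + <[f : redL2 L]>)%VS.

Lemma memv_club_space U e f (w : L * L) :
  (w : redL2 L) \in club_space U e f <->
  exists u (c : F), u \in U /\
    w = (u * e.1 + c *: f.1, u * e.2 + c *: f.2).
Proof.
split.
  move=> /memv_addP[_ /memv_imgP[u uU ->] [_ /vlineP[c ->] ->]].
  by exists u, c; split; rewrite // scale_mapE.
move=> [u [c [uU ->]]]; apply/memv_addP.
exists (scale_map e u); first exact: memv_img.
exists (c *: (f : redL2 L)); first by rewrite memvZ ?memv_line.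
by rewrite scale_mapE.
Qed.

(** The determinant condition on e and f says that they form an L-basis. *)
Section Independent.
Variables (U : {vspace L}) (e f : L2 L).
Hypothesis ef : e.1 * f.2 - e.2 * f.1 != 0.
Hypothesis dU : \dim U = 2%N.

Let p := club_space U e f.

Lemma indep_coef (a b : L) :
  a * e.1 + b * f.1 = 0 -> a * e.2 + b * f.2 = 0 -> a = 0 /\ b = 0.
Proof.
move=> h1 h2; split; apply: (mulIf ef); rewrite mul0r.
  transitivity ((a * e.1 + b * f.1) * f.2 - (a * e.2 + b * f.2) * f.1).
    ring.
  by rewrite h1 h2 !mul0r subr0.
transitivity ((a * e.2 + b * f.2) * e.1 - (a * e.1 + b * f.1) * e.2).
  ring.
by rewrite h1 h2 !mul0r subr0.
Qed.

Lemma indep_combination (a b : L) : (a != 0) || (b != 0) ->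
  ((a * e.1 + b * f.1, a * e.2 + b * f.2) : L2 L) != 0.
Proof.
move=> ab; apply/eqP => -[h1 h2].
by have [a0 b0] := indep_coef h1 h2; rewrite a0 b0 eqxx in ab.
Qed.

Lemma indep_e : e != 0.
Proof.
have := @indep_combination 1 0; rewrite oner_eq0 !mul1r !mul0r !addr0.
by case: (e) => ? ? /(_ isT).
Qed.

Lemma indep_head (a b : L) :
  ((a * e.1 + b * f.1, a * e.2 + b * f.2) : L2 L) \in <[e]>%VS -> b = 0.
Proof.
case/vlineP => k [h1 h2].
have [] // := @indep_coef (a - k) b.
  by rewrite mulrBl addrAC h1 subrr.
by rewrite mulrBl addrAC h2 subrr.
Qed.

Lemma ker_scale_map : lker (scale_map e) = 0%VS.
Proof.
apply/eqP; rewrite -subv0; apply/subvP => a; rewrite memv_ker memv0.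
rewrite scale_mapE => /eqP[h1 h2].
by have [] := @indep_coef a 0; rewrite ?mul0r ?addr0 // => ->.
Qed.

Lemma field_red_head : (field_red <[e]> :&: p = scale_map e @: U)%VS.
Proof.
apply/vspaceP => w; rewrite memv_cap memv_field_red; apply/andP/idP.
  case=> we /memv_club_space[u [c [uU wE]]]; move: we; rewrite wE.
  rewrite -[c *: f.1]mulr_algl -[c *: f.2]mulr_algl => /indep_head ->.
  rewrite !mul0r !addr0; apply/memv_imgP; exists u => //.
  by rewrite scale_mapE.
case/memv_imgP => u uU ->; rewrite scale_mapE; split.
  exact: (@memvZ _ (L2 L) _ u e (memv_line e)).
by apply/memv_club_space; exists u, 0; split=> //; rewrite !scale0r !addr0.
Qed.

Lemma dim_scale_map : \dim (scale_map e @: U) = 2%N.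
Proof. by rewrite limg_dim_eq // ker_scale_map capv0. Qed.

Lemma dim_club_space : \dim p = 3%N.
Proof.
have f0 : (f : redL2 L) != 0.
  by apply: contraNneq ef => -> /=; rewrite !mulr0 subrr.
rewrite dimv_disjoint_sum ?dim_scale_map ?dim_vline ?f0 //.
apply/eqP; rewrite -subv0; apply/subvP => w; rewrite memv_cap memv0.
rewrite -field_red_head memv_cap memv_field_red => /andP[/andP[we _]].
case/vlineP => c wE; move: we; rewrite wE => h.
have := @indep_head 0 c%:A; rewrite !mul0r !add0r !mulr_algl => /(_ h) /eqP.
by rewrite scaler_eq0 oner_eq0 orbF => /eqP ->; rewrite scale0r.
Qed.

Lemma meets_in_line_head : meets_in_line p <[e]>%VS.
Proof.
split; first exact/PG1_line/indep_e.
by rewrite field_red_head dim_scale_map.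
Qed.

(** Two two-dimensional subspaces of the three-dimensional [p] share a nonzero
vector, and a nonzero vector lies in a single projective point. *)
Lemma meets_in_line_uniq X : meets_in_line p X -> X = <[e]>%VS.
Proof.
case=> X1 dX.
have := dimv_sum_cap (field_red X :&: p) (scale_map e @: U).
rewrite dX dim_scale_map => dsum.
have : (\dim ((field_red X :&: p) + (scale_map e @: U))%VS <= 3)%N.
  rewrite -dim_club_space; apply: dimvS.
  by rewrite subv_add capvSr addvSl.
set A := (_ :&: (scale_map e @: U))%VS in dsum.
have [A0|] := eqVneq A 0%VS; first by rewrite A0 dimv0 addn0 in dsum; rewrite dsum.
rewrite -vpick0 => w0 _; have := memv_pick A.
rewrite memv_cap -field_red_head !memv_cap !memv_field_red.
move=> /andP[/andP[wX _] /andP[we _]].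
rewrite (PG1_eq X1 w0 wX); apply/esym/PG1_eq => //.
exact/PG1_line/indep_e.
Qed.

Lemma club_plane_space : club_plane p.
Proof.
split; first exact: dim_club_space.
  case=> X X1 Xp; have : \dim (field_red X :&: p) = 3%N.
    by rewrite Xp capvv dim_club_space.
  have eX : X = <[e]>%VS.
    have [u uU u0] : exists2 u, u \in U & u != 0.
      exists (vpick U); first exact: memv_pick.
      by rewrite vpick0 -dimv_eq0 dU.
    have ne : u *: e != 0 by rewrite scaler_eq0 negb_or u0 indep_e.
    rewrite (@PG1_eq X (u *: e)) //; last first.
      rewrite -memv_field_red Xp; apply/memv_club_space.
      by exists u, 0; split=> //; rewrite !scale0r !addr0.
    apply/esym/PG1_eq => //; first exact/PG1_line/indep_e.
    by rewrite memvZ ?memv_line.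
  by rewrite eX field_red_head dim_scale_map.
by exists <[e]>%VS; split; [exact: meets_in_line_head|move=> X /meets_in_line_uniq].
Qed.

(** A vector u e + c f of the plane spans the head when c = 0, and otherwise
can be rescaled by the scalar c^-1 of F. *)
Lemma B_club_space : B p =
  [set X | X = <[e]>%VS \/
           exists2 u, u \in U & X = <[u *: e + f : L2 L]>%VS].
Proof.
apply/seteqP; split=> X /=.
  case=> X1 /eqP; rewrite -vpick0.
  set w := vpick _ => w0; have := memv_pick (field_red X :&: p).
  rewrite -/w memv_cap memv_field_red => /andP[wX].
  case/memv_club_space => u [c [uU wE]].
  have XE := PG1_eq X1 w0 wX.
  have [c0|c0] := eqVneq c 0.
    left; rewrite XE; apply/esym/PG1_eq => //; first exact/PG1_line/indep_e.
    rewrite wE c0 !scale0r !addr0.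
    exact: (@memvZ _ (L2 L) _ u e (memv_line e)).
  right; exists (c^-1 *: u); first exact: memvZ.
  apply: PG1_eq => //.
    have := @indep_combination (c^-1 *: u) 1; rewrite oner_eq0 orbT !mul1r.
    by move=> /(_ isT).
  rewrite XE; apply/vlineP; exists (c^-1)%:A; rewrite wE.
  have normalize (x y : L) :
      (c^-1 *: u) * x + y = (c^-1)%:A * (u * x + c *: y).
    by rewrite mulr_algl scalerDr scalerA mulVf // scale1r scalerAl.
  by congr pair; apply: normalize.
case=> [->|[u uU ->]].
  split; first exact/PG1_line/indep_e.
  by rewrite field_red_head => /eqP; rewrite -dimv_eq0 dim_scale_map.
have n0 : u *: e + f != 0.
  have := @indep_combination u 1; rewrite oner_eq0 orbT !mul1r.
  by move=> /(_ isT).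
split; first exact: PG1_line.
move=> /vspaceP/(_ (u *: e + f)); rewrite memv0 memv_cap memv_field_red memv_line.
rewrite [X in _ = X](negbTE n0) /=.
suff -> : (u *: e + f : redL2 L) \in p by [].
by apply/memv_club_space; exists u, 1; rewrite !scale1r.
Qed.

End Independent.
Implicit Types (o : option L).

(** * Two families of clubs *)

Definition proj_point o : {vspace L2 L} :=
  if o is Some x then <[(x, 1)%R : L2 L]>%VS else <[(1, 0)%R : L2 L]>%VS.

Lemma pair_neq0 (a b : L) : (((a, b) : L2 L) != 0) = (a != 0) || (b != 0).
Proof. by rewrite -negb_and; congr (~~ _); apply: xpair_eqE. Qed.

Lemma proj_point_inj : injective proj_point.
Proof.
move=> [x|] [y|] //= /vspaceP h.
- have := h (x, 1); rewrite memv_line => /esym/vlineP[k [xE kE]].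
  by congr Some; rewrite xE -[k]mulr1 -[_ * 1]kE; apply: mul1r.
- have := h (x, 1); rewrite memv_line => /esym/vlineP[k [_ /eqP]].
  by rewrite [_ *: _]mulr0 oner_eq0.
- have := h (y, 1); rewrite memv_line => /vlineP[k [_ /eqP]].
  by rewrite [_ *: _]mulr0 oner_eq0.
Qed.

Lemma proj_point_frac (a b : L) : b != 0 ->
  <[(a, b)%R : L2 L]>%VS = proj_point (Some (a / b)).
Proof.
move=> b0; apply/esym/PG1_eq.
- by apply: PG1_line; rewrite pair_neq0 oner_eq0 orbT.
- by rewrite pair_neq0 b0 orbT.
- apply/vlineP; exists b; congr pair; last by rewrite [RHS]mulr1.
  by rewrite [RHS]mulrC divfK.
Qed.

Lemma proj_point_infty (a : L) : a != 0 ->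
  <[(a, 0)%R : L2 L]>%VS = proj_point None.
Proof.
move=> a0; apply/esym/PG1_eq.
- by apply: PG1_line; rewrite pair_neq0 oner_eq0.
- by rewrite pair_neq0 a0.
- apply/vlineP; exists a; congr pair; first by rewrite [RHS]mulr1.
  by rewrite [RHS]mulr0.
Qed.

(** The club of the basis (w, 0), (v, 1). *)
Definition affine_club U (w v : L) : set (option L) :=
  [set o | if o is Some x then (x - v) / w \in U else True].

(** The club of the basis (0, 1), (d, v).  The head x = 0 is listed separately
because [d / 0 = 0] would give a wrong condition there. *)
Definition inverse_club U (d v : L) : set (option L) :=
  [set o | if o is Some x then x = 0 \/ d / x - v \in U else v \in U].

Lemma affine_club_head U (w v : L) : \dim U = 2%N -> w != 0 ->
  is_head (proj_point @` affine_club U w v) (proj_point None).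
Proof.
move=> dU w0; pose e : L2 L := (w, 0); pose f : L2 L := (v, 1).
have ef : e.1 * f.2 - e.2 * f.1 != 0 by rewrite /= mulr1 mul0r subr0.
rewrite -(proj_point_infty w0); exists (club_space U e f).
split; [exact: club_plane_space| |exact: meets_in_line_head].
rewrite B_club_space //; apply/seteqP; split=> X /=.
  case=> -[x|] /= h <-; last by left; exact/esym/proj_point_infty.
  right; exists ((x - v) / w) => //.
  have -> : (((x - v) / w) *: e + f : L2 L) = (x, 1) by
    congr pair; rewrite /= ?[_ *: _]mulr0 ?add0r // [_ *: _]divfK // subrK.
  by [].
case=> [->|[u uU ->]]; first by exists None => //; rewrite (proj_point_infty w0).
exists (Some (u * w + v)); first by rewrite /= addrK mulfK.
by congr (<[_]>%VS); congr pair; rewrite /= [_ *: _]mulr0 add0r.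
Qed.

Lemma inverse_club_head U (d v : L) : \dim U = 2%N -> d != 0 ->
  is_head (proj_point @` inverse_club U d v) (proj_point (Some 0)).
Proof.
move=> dU d0; pose e : L2 L := (0, 1); pose f : L2 L := (d, v).
have ef : e.1 * f.2 - e.2 * f.1 != 0 by rewrite /= mul1r mul0r sub0r oppr_eq0.
exists (club_space U e f).
split; [exact: club_plane_space| |exact: meets_in_line_head].
have comb u : (u *: e + f : L2 L) = (d, u + v).
  by congr pair; rewrite /= ?[_ *: 0]mulr0 ?add0r // [_ *: 1]mulr1.
rewrite B_club_space //; apply/seteqP; split=> X /=.
  case=> -[x|] /= h <-; last first.
    right; exists (- v); first by rewrite memvN.
    rewrite comb addNr; exact/esym/proj_point_infty.
  have [->|x0] := eqVneq x 0; first by left.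
  case: h => [/eqP|h]; first by rewrite (negbTE x0).
  right; exists (d / x - v) => //; rewrite comb subrK.
  rewrite [RHS]proj_point_frac ?mulf_neq0 ?invr_neq0 //.
  by rewrite invfM invrK mulrA mulfV // mul1r.
case=> [->|[u uU ->]]; first by exists (Some 0) => //; left.
rewrite comb; have [uv0|uv0] := eqVneq (u + v) 0.
  exists None; last by rewrite uv0 proj_point_infty.
  by rewrite /= -memvN -(addKr u v) uv0 addr0 opprK.
exists (Some (d / (u + v))); last by rewrite proj_point_frac.
by right; rewrite invfM invrK mulrA mulfV // mul1r addrK.
Qed.

Lemma head_is_club C (H : {vspace L2 L}) : is_head C H -> is_club C.
Proof. by case=> p [? ? ?]; exists p. Qed.

Lemma proj_point_image_neq (A A' : set (option L)) o :
  A o -> ~ A' o -> proj_point @` A <> proj_point @` A'.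
Proof.
move=> Ao A'o eqA; have : (proj_point @` A) (proj_point o) by exists o.
by rewrite eqA => -[o' A'o' /proj_point_inj eo]; apply: A'o; rewrite -eo.
Qed.

Lemma proj_point_image_setI (A A' : set (option L)) :
  proj_point @` A `&` proj_point @` A' = proj_point @` (A `&` A').
Proof.
apply/seteqP; split=> X /=.
  by case=> -[o Ao <-] [o' + /proj_point_inj eo]; rewrite eo => A'o; exists o.
by case=> o [Ao A'o] <-; split; exists o.
Qed.

Lemma card_range (T : finType) (S : Type) (f : T -> S) : injective f ->
  (range f #= `I_#|T|)%card.
Proof.
move=> f_inj; apply: card_eq_trans (inj_card_eq (in2W f_inj)) _.
have rank_inj : injective (fun t : T => val (enum_rank t)).
  by move=> t t' /val_inj/enum_rank_inj.
rewrite card_eq_sym.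
suff <- : range (fun t : T => val (enum_rank t)) = `I_#|T|.
  exact: inj_card_eq (in2W rank_inj).
apply/seteqP; split=> [_ [t _ <-]|k /= k_lt]; first exact: ltn_ord.
by exists (enum_val (Ordinal k_lt)) => //; rewrite enum_valK.
Qed.

(** * The canonical subline *)

Definition base_points : set (option L) :=
  [set o | if o is Some x then x \in 1%VS else True].

(** <(a, b)> with a, b in F and b nonzero is the point a / b of F. *)
Lemma canonical_sublineE : @canonical_subline F L = proj_point @` base_points.
Proof.
apply/seteqP; split=> X /=.
  case=> -[a b] /= ab <-; have [b0|b0] := eqVneq b 0.
    exists None => //; rewrite b0 scale0r proj_point_infty //.
    by rewrite scaler_eq0 oner_eq0 orbF; apply/eqP => a0; apply: ab; rewrite a0 b0.
  exists (Some (a%:A / b%:A)); first by rewrite /= rpred_div ?rpredZ ?rpred1.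
  by rewrite proj_point_frac // scaler_eq0 oner_eq0 orbF.
case=> -[x|] /= h <-; last first.
  by exists (1, 0) => //=; [case=> /eqP; rewrite oner_eq0|rewrite scale1r scale0r].
case/vlineP: h => k ->; exists (k, 1); last by rewrite /= scale1r.
by case=> _ /eqP; rewrite oner_eq0.
Qed.

Lemma canonical_is_Fline : is_Fline (@canonical_subline F L).
Proof.
exists \1%VF; first by apply/eqP; apply/lker0P => x y; rewrite !lfunE.
rewrite -[LHS]image_id; apply: eq_imagel => X _; by rewrite lim1g.
Qed.

Lemma two_clubs (A1 A2 : set (option L)) (H1 H2 : {vspace L2 L}) o
    (T : finType) (f : T -> option L) :
  is_head (proj_point @` A1) H1 -> is_head (proj_point @` A2) H2 ->
  A1 o -> ~ A2 o -> injective f -> A1 `&` A2 = range f ->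
  exists C1 C2 : set {vspace L2 L},
    [/\ is_club C1, is_club C2, C1 <> C2 & (C1 `&` C2 #= `I_#|T|)%card].
Proof.
move=> h1 h2 A1o A2o f_inj capE.
exists (proj_point @` A1), (proj_point @` A2); split.
- exact: head_is_club h1.
- exact: head_is_club h2.
- exact: proj_point_image_neq A1o A2o.
rewrite proj_point_image_setI capE image_comp; apply: card_range.
exact: inj_comp (proj_point_inj) f_inj.
Qed.

(** * Polynomials of degree at most 2 in a generator *)

(** The degree of an element outside F divides the prime 3, hence equals 3; so no
nonzero polynomial of degree at most 2 vanishes on it. *)
Lemma cubic_generator : \dim {:L} = 3%N ->
  exists theta : L, forall a b c : F,
    a%:A + b%:A * theta + c%:A * theta ^+ 2 = 0 -> [/\ a = 0, b = 0 & c = 0].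
Proof.
move=> dL; have : ~~ ({:L} <= 1%AS)%VS.
  by apply/negP => /dimvS; rewrite dL dimv1.
case/subvPn => theta _ theta1; exists theta => a b c abc0.
have deg3 : adjoin_degree 1%AS theta = 3%N.
  have : (\dim <<1%AS; theta>> %| 3)%N by rewrite -dL field_dimS ?subvf.
  rewrite dim_Fadjoin dimv1 muln1.
  move/(prime_nt_dvdP (isT : prime 3)); apply.
  by rewrite adjoin_deg_eq1.
pose p := Poly [:: a%:A; b%:A; c%:A : L].
have p1 : p \is a polyOver 1%VS.
  apply/polyOverP => i; rewrite coef_Poly.
  by case: i => [|[|[|i]]] /=; rewrite ?nth_nil ?rpred0 ?rpredZ ?rpred1.
have := @root_small_adjoin_poly _ _ 1%AS theta _ p1.
rewrite deg3 size_Poly => /(_ isT).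
have -> : root p theta.
  rewrite /root horner_Poly /= mul0r add0r.
  by apply/eqP; rewrite -[RHS]abc0 -!in_algE; ring.
move/esym/eqP/polyP => p0.
have inA (k : F) : (k%:A : L) = 0 -> k = 0.
  by move/eqP; rewrite scaler_eq0 oner_eq0 orbF => /eqP.
by split; apply: inA; [have := p0 0%N|have := p0 1%N|have := p0 2%N];
  rewrite coef_Poly coef0.
Qed.

Section Generator.
Variable theta : L.
Hypothesis dL : \dim {:L} = 3%N.
Hypothesis indep : forall a b c : F,
  a%:A + b%:A * theta + c%:A * theta ^+ 2 = 0 -> [/\ a = 0, b = 0 & c = 0].

Let U : {vspace L} := (<[1]> + <[theta]>)%VS.

Lemma mem_lin x : x \in U <-> exists a b : F, x = a%:A + b%:A * theta.
Proof.
split.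
  case/memv_addP => _ /vlineP[a ->] [_ /vlineP[b ->] ->].
  by exists a, b; rewrite mulr_algl.
case=> a [b ->]; apply: memv_add; first by rewrite memvZ ?memv_line.
by rewrite mulr_algl memvZ ?memv_line.
Qed.

Lemma coef_eq (a b c a' b' c' : F) :
  a%:A + b%:A * theta + c%:A * theta ^+ 2 =
  a'%:A + b'%:A * theta + c'%:A * theta ^+ 2 ->
  [/\ a = a', b = b' & c = c'].
Proof.
move=> h; have [] := @indep (a - a') (b - b') (c - c').
  move/eqP: h; rewrite -subr_eq0 => /eqP h; rewrite -[RHS]h -!in_algE; ring.
by do 3![move/eqP; rewrite subr_eq0 => /eqP ->].
Qed.

Lemma coef_lin (a b a' b' : F) :
  a%:A + b%:A * theta = a'%:A + b'%:A * theta -> a = a' /\ b = b'.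
Proof.
move=> h; have [] // := @coef_eq a b 0 a' b' 0.
by rewrite h.
Qed.

(** Products of two elements of [U] have degree at most 2, so they are computed
as products of polynomials. *)
Lemma coef_mul (a b c a1 b1 a2 b2 : F) :
  a%:A + b%:A * theta + c%:A * theta ^+ 2 =
  (a1%:A + b1%:A * theta) * (a2%:A + b2%:A * theta) ->
  [/\ a = a1 * a2, b = a1 * b2 + b1 * a2 & c = b1 * b2].
Proof. by move=> h; apply: coef_eq; rewrite h -!in_algE; ring. Qed.

Lemma scalar_eq0 (a : F) : (a%:A == 0 :> L) = (a == 0).
Proof. by rewrite scaler_eq0 oner_eq0 orbF. Qed.

Lemma theta_neq0 : theta != 0.
Proof.
apply/eqP => t0; have [] := @indep 0 1 0.
  by rewrite t0 !mulr0 !scale0r mul0r !addr0.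
by move=> _ /eqP; rewrite oner_eq0.
Qed.

Lemma dim_lin : \dim U = 2%N.
Proof.
rewrite dimv_disjoint_sum ?dim_vline ?oner_eq0 ?theta_neq0 //.
apply/eqP; rewrite -subv0; apply/subvP => x; rewrite memv_cap memv0.
case/andP => /vlineP[a ->] /vlineP[b h]; rewrite scalar_eq0.
have [] := @coef_lin a 0 0 b; last by move=> ->.
by rewrite h !scale0r mul0r addr0 add0r mulr_algl.
Qed.

Lemma sqr_notin : theta ^+ 2 \notin U.
Proof.
apply/negP => /mem_lin[a [b h]]; have [] := @coef_eq 0 0 1 a b 0.
  by rewrite h !scale0r !mul0r scale1r mul1r !addr0 !add0r.
by move=> _ _ /eqP; rewrite oner_eq0.
Qed.

(** [lam] is the coefficient of theta^2: [U] consists of the elements without a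
quadratic term. *)
Lemma top_coef : exists lam : L -> F,
  forall x c, x - c%:A * theta ^+ 2 \in U <-> c = lam x.
Proof.
have full : (U + <[theta ^+ 2]>)%VS = fullv.
  apply/eqP; rewrite eqEdim subvf dL.
  rewrite dimv_disjoint_sum ?dim_lin ?dim_vline.
    by case: eqP => // t0; have := sqr_notin; rewrite t0 mem0v.
  apply/eqP; rewrite -subv0; apply/subvP => x; rewrite memv_cap memv0.
  case/andP => + /vlineP[c xE]; rewrite xE; have [->|c0] := eqVneq c 0.
    by rewrite scale0r.
  by move/(memvZ c^-1); rewrite scalerA mulVf // scale1r (negbTE sqr_notin).
have ex x : exists c : F, x - c%:A * theta ^+ 2 \in U.
  have : x \in (U + <[theta ^+ 2]>)%VS by rewrite full memvf.
  case/memv_addP => u uU [_ /vlineP[c ->] ->]; exists c.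
  by rewrite mulr_algl addrK.
have [lam lamP] := choice ex; exists lam => x c; split=> [h|->]; last exact: lamP.
apply/eqP; rewrite -subr_eq0; apply: contraNT sqr_notin => cl0.
have := memvB (lamP x) h.
have -> : x - (lam x)%:A * theta ^+ 2 - (x - c%:A * theta ^+ 2)
   = (c - lam x) *: theta ^+ 2.
  by rewrite -[RHS]mulr_algl -!in_algE; ring.
by move/(memvZ (c - lam x)^-1); rewrite scalerA mulVf // scale1r.
Qed.

Let std_club := affine_club U 1 0.

Lemma mem_std_club x : std_club (Some x) = (x \in U).
Proof. by rewrite /std_club /affine_club /= subr0 divr1. Qed.

(** In every finite field the map x |-> x^2 - x is not onto because it identifies 0
and 1, so X^2 - X - c is irreducible for some c.  This is uniform in the
characteristic, unlike the use of a nonsquare. *)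
Lemma irreducible_quadratic : exists2 d, d != 0 &
  forall x, x \in U -> x != 0 -> d / x \notin U.
Proof.
pose g (x : F) := x ^+ 2 - x.
have /existsP[d dP] : [exists d, d \notin codom g].
  rewrite -negb_forall; apply/negP => /forallP g_onto.
  have /image_injP g_inj : #|[seq g x | x in F]| == #|F|.
    by apply/eqP/eq_card => x; rewrite g_onto.
  have := g_inj 1 0 isT isT; rewrite /g expr1n expr0n !subrr => /(_ erefl)/eqP.
  by rewrite oner_eq0.
pose Q := theta ^+ 2 - theta - d%:A.
suff no_factor y z : y \in U -> z \in U -> y * z <> Q.
  exists Q => [|x xU x0].
    by apply/eqP => Q0; apply: (@no_factor 0 0); rewrite ?mem0v // mulr0 Q0.
  by apply/negP => /(no_factor _ _ xU); rewrite mulrC divfK.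
move=> /mem_lin[a1 [b1 ->]] /mem_lin[a2 [b2 ->]] h.
have [] := @coef_mul (- d) (-1) 1 a1 b1 a2 b2; first by rewrite h /Q -!in_algE; ring.
(* - a1 / b1 is a root of X^2 - X - d, and b2 is the inverse of b1. *)
move=> h0 h1 h2; case/negP: dP; apply/codomP; exists (- a1 * b2).
have {h1} h1 : b1 * a2 = -1 - a1 * b2 by rewrite h1; ring.
transitivity (- (- d) * (b1 * b2)); first by rewrite -h2 opprK mulr1.
rewrite h0; transitivity (- (a1 * b2) * (b1 * a2)); first ring.
by rewrite h1 /g; ring.
Qed.

Lemma one_lin : 1 \in U.
Proof. by apply/mem_lin; exists 1, 0; rewrite scale1r scale0r mul0r addr0. Qed.

Lemma theta_lin : theta \in U.
Proof. by apply/mem_lin; exists 0, 1; rewrite !scale0r !scale1r add0r mul1r. Qed.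

Lemma shift_lin t : theta + t%:A \in U.
Proof. by rewrite memvD ?theta_lin ?memvZ ?one_lin. Qed.

Lemma shift_neq0 t : theta + t%:A != 0.
Proof.
apply/eqP => t0; have [] := @indep t 1 0.
  by rewrite scale1r mul1r scale0r mul0r addr0 addrC.
by move=> _ /eqP; rewrite oner_eq0.
Qed.

Lemma scalarV (a : F) : (a%:A : L)^-1 = (a^-1)%:A.
Proof. by rewrite -!in_algE fmorphV. Qed.

(** The factors of the polynomial X are the constants and the multiples of X. *)
Lemma theta_factor x : x \in U -> theta / x \in U -> x != 0 ->
  (exists2 a : F, a != 0 & x = a%:A) \/ (exists2 b : F, b != 0 & x = b%:A * theta).
Proof.
move=> /mem_lin[a [b xE]] /mem_lin[a' [b' yE]] x0.
have [] := @coef_mul 0 1 0 a b a' b'.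
  by rewrite -xE -yE [RHS]mulrC divfK // !scale0r mul0r scale1r mul1r addr0 add0r.
move=> /esym/eqP; rewrite mulf_eq0 => /orP[/eqP a0|/eqP a'0] h1 h2; [right|left].
  exists b; last by rewrite xE a0 scale0r add0r.
  by apply: contraNneq x0 => b0; rewrite xE a0 b0 !scale0r mul0r addr0.
have b0 : b = 0.
  move: h2 h1 => /esym/eqP; rewrite mulf_eq0 => /orP[/eqP //|/eqP b'0].
  by rewrite a'0 b'0 !mulr0 addr0 => /eqP; rewrite oner_eq0.
exists a; last by rewrite xE b0 scale0r mul0r addr0.
by apply: contraNneq x0 => a0; rewrite xE a0 b0 !scale0r mul0r addr0.
Qed.

Lemma std_club_head : is_head (proj_point @` std_club) (proj_point None).
Proof. by apply: affine_club_head; rewrite ?dim_lin ?oner_eq0. Qed.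

Definition base_point (o : option F) : option L := omap (fun a => a%:A) o.

Lemma scalar_inj : injective (fun a : F => a%:A : L).
Proof. exact: fmorph_inj (in_alg L). Qed.

Lemma base_point_inj : injective base_point.
Proof. exact: (inj_omap scalar_inj). Qed.

Lemma base_pointsE : base_points = range base_point.
Proof.
apply/seteqP; split=> [[x|] /= |_ [[a|] _ <-] //=].
- by case/vlineP => k ->; exists (Some k).
- by exists None.
- by rewrite memvZ ?memv_line.
Qed.

Lemma theta_not_base : ~ base_points (Some theta).
Proof.
case/vlineP => k tE; have [] := @coef_lin 0 1 k 0.
  by rewrite -tE !scale0r scale1r mul0r mul1r add0r addr0.
by move=> _ /eqP; rewrite oner_eq0.
Qed.

(** * Intersections equal to the canonical subline *)

Lemma affine_cap_base : std_club `&` affine_club U theta^-1 0 = base_points.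
Proof.
apply/seteqP; split=> [[x|] //=|[x|] //=].
  rewrite !subr0 divr1 invrK => -[/mem_lin[a [b ->]] /mem_lin[a' [b' h]]].
  have [] := @coef_eq 0 a b a' b' 0.
    by rewrite !scale0r mul0r addr0 add0r -h -!in_algE; ring.
  by move=> _ _ ->; rewrite scale0r mul0r addr0 memvZ ?memv_line.
case/vlineP => k ->; rewrite !subr0 divr1 invrK mulr_algl.
by rewrite !memvZ ?one_lin ?theta_lin.
Qed.

(** The constant polynomial 1 = (a + b X) (a' + b' X) forces b = 0, so that a common
point x = a + b theta lies in F. *)
Lemma inverse_cap_base : std_club `&` inverse_club U 1 0 = base_points.
Proof.
apply/seteqP; split=> [[x|] //=|[x|] //=]; last by split=> //; apply: mem0v.
  rewrite !subr0 divr1; have [->|x0] := eqVneq x 0; first by move=> _; apply: mem0v.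
  case=> xU [/eqP|]; first by rewrite (negbTE x0).
  move: xU => /mem_lin[a [b xE]] /mem_lin[a' [b' yE]].
  have [] := @coef_mul 1 0 0 a b a' b'.
    by rewrite -xE -yE [RHS]mulrC divfK // !scale0r !mul0r scale1r !addr0.
  move=> h0 h1 /esym/eqP; rewrite mulf_eq0 => /orP[/eqP b0|/eqP b'0].
    by rewrite xE b0 scale0r mul0r addr0 memvZ ?memv_line.
  move: h1; rewrite b'0 mulr0 add0r => /esym/eqP; rewrite mulf_eq0.
  case/orP => /eqP z0; first by rewrite xE z0 scale0r mul0r addr0 memvZ ?memv_line.
  by move/eqP: h0; rewrite z0 mulr0 oner_eq0.
case/vlineP => k ->; rewrite !subr0 divr1 memvZ ?one_lin //; split=> //.
have -> : (1 / k%:A : L) = k^-1 *: 1 by rewrite div1r scalarV.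
by right; rewrite memvZ ?one_lin.
Qed.

(** * Intersection sizes *)

Lemma clubs_meet_1 : exists C1 C2 : set {vspace L2 L},
  [/\ is_club C1, is_club C2, C1 <> C2 & (C1 `&` C2 #= `I_1)%card].
Proof.
have h2 : is_head (proj_point @` affine_club U 1 (theta ^+ 2)) (proj_point None).
  by apply: affine_club_head; rewrite ?dim_lin ?oner_eq0.
rewrite -card_unit.
apply: (two_clubs (o := Some 0) (f := fun _ : unit => None) std_club_head h2).
- by rewrite mem_std_club mem0v.
- by rewrite /= divr1 sub0r memvN (negbTE sqr_notin).
- by move=> [] [].
apply/seteqP; split=> [[x|] /=|_ [_ _ <-] //].
  rewrite subr0 !divr1 => -[xU /(memvB xU)].
  by rewrite opprB addrC subrK (negbTE sqr_notin).
by exists tt.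
Qed.

Lemma clubs_meet_succ_q : exists C1 C2 : set {vspace L2 L},
  [/\ is_club C1, is_club C2, C1 <> C2 & (C1 `&` C2 #= `I_(#|F|.+1))%card].
Proof.
have h2 : is_head (proj_point @` inverse_club U 1 0) (proj_point (Some 0)).
  by apply: inverse_club_head; rewrite ?dim_lin ?oner_eq0.
rewrite -card_option.
apply: (two_clubs (o := Some theta) std_club_head h2 _ _ base_point_inj).
- by rewrite mem_std_club theta_lin.
- move=> hT; apply: theta_not_base; rewrite -inverse_cap_base.
  by split=> //; rewrite mem_std_club theta_lin.
by rewrite inverse_cap_base base_pointsE.
Qed.

Lemma clubs_meet_2 : exists C1 C2 : set {vspace L2 L},
  [/\ is_club C1, is_club C2, C1 <> C2 & (C1 `&` C2 #= `I_2)%card].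
Proof.
have [d d0 notU] := irreducible_quadratic.
have h2 : is_head (proj_point @` inverse_club U d 0) (proj_point (Some 0)).
  by apply: inverse_club_head; rewrite ?dim_lin.
rewrite -card_bool.
apply: (two_clubs (o := Some 1)
  (f := fun b : bool => if b then None else Some 0) std_club_head h2).
- by rewrite mem_std_club one_lin.
- rewrite /= subr0 => -[/eqP|]; first by rewrite oner_eq0.
  by apply/negP/notU; rewrite ?one_lin ?oner_eq0.
- by move=> [] [].
apply/seteqP; split=> [[x|] /=|_ [[] _ <-]].
- rewrite !subr0 divr1 => -[xU [->|dx]]; first by exists false.
  have [->|x0] := eqVneq x 0; first by exists false.
  by rewrite (negbTE (notU _ xU x0)) in dx.
- by exists true.
- by split=> //=; rewrite mem0v.
- by split; [rewrite mem_std_club mem0v|left].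
Qed.

(** The common points are 0, infinity, and the nonzero multiples of 1 and of theta
by scalars; the value 0 of the parameter accounts for 0 and infinity. *)
Lemma clubs_meet_double_q : exists C1 C2 : set {vspace L2 L},
  [/\ is_club C1, is_club C2, C1 <> C2 & (C1 `&` C2 #= `I_(2 * #|F|))%card].
Proof.
have h2 : is_head (proj_point @` inverse_club U theta 0) (proj_point (Some 0)).
  by apply: inverse_club_head; rewrite ?dim_lin ?theta_neq0.
rewrite -card_bool -card_prod.
pose f (s : bool * F) : option L :=
  if s.1 then Some s.2%:A
  else if s.2 == 0 then None else Some (s.2%:A * theta).
apply: (two_clubs (o := Some (theta + 1)) (f := f) std_club_head h2).
- by rewrite mem_std_club memvD ?one_lin ?theta_lin.
- have t1 := shift_neq0 1; rewrite scale1r in t1.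
  rewrite /= subr0 => -[/eqP|tU]; first by rewrite (negbTE t1).
  have t1U : theta + 1 \in U by rewrite memvD ?one_lin ?theta_lin.
  case: (theta_factor t1U tU t1) => -[a _ aE].
    have [] := @coef_lin 1 1 a 0; last by move=> _ /eqP; rewrite oner_eq0.
    by rewrite -aE !scale1r mul1r scale0r mul0r addr0 addrC.
  have [] := @coef_lin 1 1 0 a; last by move=> /eqP; rewrite oner_eq0.
  by rewrite -aE !scale1r mul1r scale0r add0r addrC.
- move=> [[] a] [[] b]; rewrite /f /=.
  + by case=> /scalar_inj ->.
  + case: eqP => // b0 [h]; have [] := @coef_lin a 0 0 b.
      by rewrite !scale0r mul0r add0r addr0.
    by move=> _ /esym/b0.
  + case: eqP => // b0 [h]; have [] := @coef_lin 0 a b 0.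
      by rewrite !scale0r mul0r add0r addr0.
    by move=> _ /b0.
  case: eqP => [->|_]; case: eqP => [->|_] // [/(mulIf theta_neq0)/scalar_inj] ->.
  by [].
apply/seteqP; split=> [[x|] /=|_ [[[] a] _ <-]].
- rewrite !subr0 divr1 => -[xU [x0|dx]].
    by exists (true, 0) => //; rewrite /f /= scale0r x0.
  have [->|x0] := eqVneq x 0; first by exists (true, 0); rewrite // /f /= scale0r.
  case: (theta_factor xU dx x0) => -[a a0 ->]; first by exists (true, a).
  by exists (false, a) => //; rewrite /f /= (negbTE a0).
- by exists (false, 0); rewrite // /f /= eqxx.
- rewrite /f /=; split; first by rewrite subr0 divr1 memvZ ?one_lin.
  have [->|a0] := eqVneq a 0; first by left; rewrite scale0r.
  right; rewrite subr0 scalarV mulrC mulr_algl.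
  by rewrite memvZ ?theta_lin.
rewrite /f /=; case: eqP => [_|/eqP a0]; first by split=> //=; rewrite mem0v.
split; first by rewrite /= subr0 divr1 mulr_algl memvZ ?theta_lin.
right; rewrite subr0 invfM mulrCA divff ?theta_neq0 // mulr1.
by rewrite scalarV memvZ ?one_lin.
Qed.

(** On the line spanned by y, the condition d / x in U + theta^2 selects the
multiple by the theta^2-coefficient of d / y, provided this is not zero. *)
Lemma top_coef_scale (lam : L -> F) d y c :
  (forall x c, x - c%:A * theta ^+ 2 \in U <-> c = lam x) -> c != 0 ->
  d / (c%:A * y) - theta ^+ 2 \in U <-> c = lam (d / y).
Proof.
move=> lamP c0; rewrite -lamP.
have cA0 : (c%:A : L) != 0 by rewrite scalar_eq0.
have -> : d / y - c%:A * theta ^+ 2 = c *: (d / (c%:A * y) - theta ^+ 2).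
  by rewrite -[RHS]mulr_algl mulrBr invfM [in RHS]mulrCA mulVKf.
split=> [/(memvZ c) //|/(memvZ c^-1)].
by rewrite scalerA mulVf // scale1r.
Qed.

Lemma inverse_sqr_head d : d != 0 ->
  is_head (proj_point @` inverse_club U d (theta ^+ 2)) (proj_point (Some 0)).
Proof. by move=> d0; apply: inverse_club_head; rewrite ?dim_lin. Qed.

Lemma infty_notin d : ~ inverse_club U d (theta ^+ 2) None.
Proof. by rewrite /= (negbTE sqr_notin). Qed.

(** The one-dimensional subspaces of [U] are represented by 1 and the theta + t, and
[top_coef_scale] finds the selected multiple on each of them. *)
Lemma inverse_sqr_case lam d x :
  (forall x c, x - c%:A * theta ^+ 2 \in U <-> c = lam x) ->
  x \in U -> d / x - theta ^+ 2 \in U -> x != 0 ->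
  x = (lam d)%:A \/
  exists t : F, x = (lam (d / (theta + t%:A)))%:A * (theta + t%:A).
Proof.
move=> lamP /mem_lin[a [b xE]] dx x0; have [b0|b0] := eqVneq b 0.
  have xa : x = a%:A by rewrite xE b0 scale0r mul0r addr0.
  have a0 : a != 0 by rewrite -scalar_eq0 -xa.
  left; rewrite xa; congr (_%:A); rewrite -[d]divr1.
  by apply/(top_coef_scale _ _ lamP a0); rewrite mulr1 -xa.
have bE : x = b%:A * (theta + (a / b)%:A).
  rewrite xE -!in_algE rmorphM fmorphV mulrDr mulrCA divff ?fmorph_eq0 //.
  by rewrite mulr1 addrC.
right; exists (a / b); rewrite {1}bE; congr (_%:A * _).
by apply/(top_coef_scale _ _ lamP b0); rewrite -bE.
Qed.

(** The subspaces of theta and 1 contain no selected multiple.  The formula for the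
selected multiple of theta + t gives 0 at t = 0, so the head 0, which is a common
point, takes the place missing there and F parametrizes the intersection. *)
Lemma clubs_meet_q : exists C1 C2 : set {vspace L2 L},
  [/\ is_club C1, is_club C2, C1 <> C2 & (C1 `&` C2 #= `I_(#|F|))%card].
Proof.
have [lam lamP] := top_coef.
have h2 := inverse_sqr_head theta_neq0.
pose l t := lam (theta / (theta + t%:A)).
have l_eq0 t : l t = 0 -> t = 0.
  move=> lt0; have tU : theta / (theta + t%:A) \in U.
    by have /lamP := esym lt0; rewrite scale0r mul0r subr0.
  case: (theta_factor (shift_lin t) tU (shift_neq0 t)) => -[a _ aE].
    have [] := @coef_lin t 1 a 0; last by move=> _ /eqP; rewrite oner_eq0.
    by rewrite -aE !scale1r mul1r scale0r mul0r addr0 addrC.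
  have [] // := @coef_lin t 1 0 a.
  by rewrite -aE !scale1r mul1r scale0r add0r addrC.
have l0 : l 0 = 0.
  apply/esym/lamP; rewrite !scale0r mul0r subr0 addr0 divff ?theta_neq0 //.
  exact: one_lin.
pose f t := Some ((l t)%:A * (theta + t%:A)).
apply: (two_clubs (o := None) (f := f) std_club_head h2 _ (@infty_notin _)) => //.
  move=> s t [st]; have [] := @coef_lin (l s * s) (l s) (l t * t) (l t).
    have expand u : (l u * u)%:A + (l u)%:A * theta = (l u)%:A * (theta + u%:A).
      by rewrite -!in_algE; ring.
    by rewrite !expand.
  move=> h lst; rewrite lst in h; have [lt0|lt0] := eqVneq (l t) 0.
    by rewrite (l_eq0 t) // (l_eq0 s) // lst.
  exact: mulfI h.
apply/seteqP; split=> [[x|] /=|_ [t _ <-]].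
- rewrite subr0 divr1 => -[xU [x0|dx]].
    by exists 0 => //; rewrite /f l0 scale0r mul0r x0.
  have [->|x0] := eqVneq x 0.
    by exists 0 => //; rewrite /f l0 scale0r mul0r.
  case: (inverse_sqr_case lamP xU dx x0) => [xE|[t xE]]; last first.
    by exists t => //; rewrite /f -xE.
  have lt0 : lam theta = 0.
    by apply/esym/lamP; rewrite scale0r mul0r subr0 theta_lin.
  by rewrite xE lt0 scale0r eqxx in x0.
- by case=> _; rewrite (negbTE sqr_notin).
split; first by rewrite mem_std_club mulr_algl memvZ ?shift_lin.
have [lt0|lt0] := eqVneq (l t) 0; first by left; rewrite lt0 scale0r mul0r.
by right; apply/(top_coef_scale _ _ lamP lt0).
Qed.

(** Every one-dimensional subspace of [U] contains a selected multiple, and the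
head 0 is added to these q + 1 points. *)
Lemma clubs_meet_q_add_2 : exists C1 C2 : set {vspace L2 L},
  [/\ is_club C1, is_club C2, C1 <> C2 & (C1 `&` C2 #= `I_(#|F|.+2))%card].
Proof.
have [lam lamP] := top_coef.
have [d d0 notU] := irreducible_quadratic.
have h2 := inverse_sqr_head d0.
have lam_neq0 x : x \in U -> x != 0 -> lam (d / x) != 0.
  move=> xU x0; apply: contra (notU x xU x0) => /eqP l0.
  by have /lamP := esym l0; rewrite scale0r mul0r subr0.
have ld0 : lam d != 0 by have := lam_neq0 1 one_lin (oner_neq0 _); rewrite divr1.
pose l t := lam (d / (theta + t%:A)).
have lt0 t : l t != 0 by apply: lam_neq0; rewrite ?shift_lin ?shift_neq0.
pose f (o : option (option F)) : option L := Some
  match o with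
  | None => 0
  | Some None => (lam d)%:A
  | Some (Some t) => (l t)%:A * (theta + t%:A)
  end.
have expand u : (l u)%:A * (theta + u%:A) = (l u * u)%:A + (l u)%:A * theta.
  by rewrite -!in_algE; ring.
have not_scalar t a : (l t)%:A * (theta + t%:A) <> a%:A :> L.
  rewrite expand => h; have [] := @coef_lin (l t * t) (l t) a 0.
    by rewrite h scale0r mul0r addr0.
  by move=> _ /eqP; rewrite (negbTE (lt0 t)).
rewrite -!card_option.
apply: (two_clubs (o := None) (f := f) std_club_head h2 _ (@infty_notin _)) => //.
  have not_0 t : (l t)%:A * (theta + t%:A) <> 0 by rewrite -(scale0r 1); apply: not_scalar.
  have ld : (lam d)%:A <> 0 :> L by apply/eqP; rewrite scalar_eq0.
  case=> [[s|]|] [[t|]|] // [].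
  - rewrite !expand => /coef_lin[h lst]; rewrite lst in h.
    by rewrite (mulfI (lt0 t) h).
  - by move/not_scalar.
  - by move/not_0.
  - by move/esym/not_scalar.
  - by move/ld.
  - by move/esym/not_0.
  - by move/esym/ld.
apply/seteqP; split=> [[x|] /=|_ [o _ <-]].
- rewrite subr0 divr1 => -[xU [->|dx]]; first by exists None.
  have [->|x0] := eqVneq x 0; first by exists None.
  case: (inverse_sqr_case lamP xU dx x0) => [xE|[t xE]].
    by exists (Some None); rewrite // /f -xE.
  by exists (Some (Some t)); rewrite // /f -xE.
- by case=> _; rewrite (negbTE sqr_notin).
case: o => [[t|]|] /=; rewrite subr0 divr1.
- split; first by rewrite mulr_algl memvZ ?shift_lin.
  by right; apply/(top_coef_scale _ _ lamP (lt0 t)).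
- split; first by rewrite memvZ ?one_lin.
  right; have := top_coef_scale d 1 lamP ld0; rewrite mulr1 divr1.
  by move=> h; apply/h.
by split; [rewrite mem0v|left].
Qed.

(** * Clubs sharing exactly a subline *)

Lemma two_heads : exists (C1 C2 : set {vspace L2 L}) (H1 H2 : {vspace L2 L}),
  [/\ is_club C1 /\ is_club C2, C1 <> C2,
      [/\ is_head C1 H1, is_head C2 H2 & H1 <> H2] & is_Fline (C1 `&` C2)].
Proof.
have h2 : is_head (proj_point @` inverse_club U 1 0) (proj_point (Some 0)).
  by apply: inverse_club_head; rewrite ?dim_lin ?oner_eq0.
exists (proj_point @` std_club), (proj_point @` inverse_club U 1 0).
exists (proj_point None), (proj_point (Some 0)); split.
- by split; [exact: head_is_club std_club_head|exact: head_is_club h2].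
- apply: (proj_point_image_neq (o := Some theta)).
    by rewrite mem_std_club theta_lin.
  move=> hT; apply: theta_not_base; rewrite -inverse_cap_base.
  by split=> //; rewrite mem_std_club theta_lin.
- by split=> [||/proj_point_inj]; [exact: std_club_head|exact: h2|].
rewrite proj_point_image_setI inverse_cap_base -canonical_sublineE.
exact: canonical_is_Fline.
Qed.

Lemma one_head : exists (C1 C2 : set {vspace L2 L}) (H : {vspace L2 L}),
  [/\ is_club C1 /\ is_club C2, C1 <> C2,
      is_head C1 H /\ is_head C2 H & is_Fline (C1 `&` C2)].
Proof.
have h2 : is_head (proj_point @` affine_club U theta^-1 0) (proj_point None).
  by apply: affine_club_head; rewrite ?dim_lin ?invr_eq0 ?theta_neq0.
exists (proj_point @` std_club), (proj_point @` affine_club U theta^-1 0).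
exists (proj_point None); split.
- by split; [exact: head_is_club std_club_head|exact: head_is_club h2].
- apply: (proj_point_image_neq (o := Some theta)).
    by rewrite mem_std_club theta_lin.
  move=> hT; apply: theta_not_base; rewrite -affine_cap_base.
  by split=> //; rewrite mem_std_club theta_lin.
- by split; [exact: std_club_head|exact: h2].
rewrite proj_point_image_setI affine_cap_base -canonical_sublineE.
exact: canonical_is_Fline.
Qed.

End Generator.
End ClubIntersections.

Theorem corollary14 (q : nat) (F : finFieldType) (L : fieldExtType F)
    (hq : #|F| = q) (hL : \dim {:L} = 3%N) :
  (forall x : nat, x \in [:: 1; 2; q; q + 1; q + 2; 2 * q]%N ->
     exists C1 C2 : set {vspace (L2 L)},
       [/\ is_club C1, is_club C2, C1 <> C2 & (C1 `&` C2 #= `I_x)%card])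
  /\
  ((exists (C1 C2 : set {vspace (L2 L)}) (H : {vspace (L2 L)}),
      [/\ is_club C1 /\ is_club C2, C1 <> C2,
          is_head C1 H /\ is_head C2 H & is_Fline (C1 `&` C2)])
   /\
   (exists (C1 C2 : set {vspace (L2 L)}) (H1 H2 : {vspace (L2 L)}),
      [/\ is_club C1 /\ is_club C2, C1 <> C2,
          [/\ is_head C1 H1, is_head C2 H2 & H1 <> H2] &
          is_Fline (C1 `&` C2)])).
Proof.
have [theta indep] := cubic_generator hL.
rewrite -hq; split; last by split; [exact: one_head indep|exact: two_heads indep].
move=> x; rewrite !inE.
case/or4P => [/eqP ->|/eqP ->|/eqP ->|/or3P[]/eqP ->].
- exact: clubs_meet_1 indep.
- exact: clubs_meet_2 indep.
- exact: clubs_meet_q hL indep.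
- by rewrite addn1; exact: clubs_meet_succ_q indep.
- by rewrite addn2; exact: clubs_meet_q_add_2 hL indep.
- exact: clubs_meet_double_q indep.
Qed.
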